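(* Let $a>1$ and $b\in\mathbb R$ be constants. Assume that $\Pi_n=O(n^{-a})$ for the fixed data distribution $P_x$, and that there exists a constant $C$ such that for all noise distributions $P_\varepsilon\in\Psi$ and all $n\in\mathbb N$ $$\frac{\Delta_n(P_\varepsilon)}{\sigma_n^2}\le C\,\boldsymbol\delta(P_\varepsilon)^2\,n^{b}.$$ Then $$\sup\Big\{\mathbb E_{x\sim P_x,\varepsilon\sim P_\varepsilon}\big[\|A^\dagger Ax-R^{\mathrm{MSE}}_{P_\varepsilon}(Ax+\varepsilon)\|^2\big]\ \Big|\ P_\varepsilon\in\Psi,\ \boldsymbol\delta(P_\varepsilon)\le\delta\Big\}\lesssim\delta^{2\frac{a-1}{a+b}},$$ where $\lesssim$ means inequality up to a multiplicative constant independent of $\delta$.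
   Context: $X,Y$ are real Hilbert spaces and $A:X\to Y$ is a compact linear operator with singular value expansion $Ax=\sum_{n\in\mathbb N}\sigma_n\langle x,u_n\rangle v_n$, where $\sigma_n>0$, $(u_n)$ is an orthonormal basis of $\mathcal N(A)^\perp$ and $(v_n)$ is an orthonormal basis of $\overline{\mathcal R(A)}$; $\mathbb N=\{1,2,\dots\}$. $A^\dagger$ is the pseudo-inverse, so $A^\dagger A$ is the orthogonal projection onto $\mathcal N(A)^\perp$. $P_x$ is a fixed probability distribution on $X$ with $\mathbb E_{x\sim P_x}[\|x\|^2]<\infty$. $\Psi$ is a family of noise distributions $P_\varepsilon$. The noise $\varepsilon\sim P_\varepsilon$ is independent of $x$, has zero mean, and enters only through its coefficients $\langle\varepsilon,v_n\rangle$, which are zero-mean square-integrable real random variables (so white noise, which is not $Y$-valued, is allowed). $\Pi_n=\mathbb E_{x\sim P_x}[\langle x,u_n\rangle^2]$ and $\Delta_n=\Delta_n(P_\varepsilon)=\mathbb E_{\varepsilon\sim P_\varepsilon}[\langle\varepsilon,v_n\rangle^2]$. The noise level is $\boldsymbol\delta(P_\varepsilon)=\sqrt{\sup_{n}\Delta_n(P_\varepsilon)}$. For a real sequence $g$, $R[g](y)=\sum_n g_n\langle y,v_n\rangle u_n$; in particular $R[g](Ax+\varepsilon)=\sum_n g_n(\sigma_n\langle x,u_n\rangle+\langle\varepsilon,v_n\rangle)u_n$. The learned operator is $R^{\mathrm{MSE}}_{P_\varepsilon}=R[g^{\mathrm{MSE}}_{P_\varepsilon,P_x}]$ with $(g^{\mathrm{MSE}}_{P_\varepsilon,P_x})_n=\frac{\sigma_n\Pi_n}{\Pi_n\sigma_n^2+\Delta_n}$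 (convention $0/0=0$), which minimizes $g\mapsto\mathbb E_{x,\varepsilon}[\|R[g](Ax+\varepsilon)-x\|^2]$.
   Formalization: The constant b is assumed to satisfy b > -1 instead of being an arbitrary real; for b <= -1 the claimed rate is false (or, at b = -a, its exponent is undefined), e.g. for noise in the first coefficient only when -a < b < -1. *)

(* Defs.v *)
From HB Require Import structures.
From mathcomp Require Import all_boot all_order all_algebra.
From mathcomp Require Import all_classical all_reals all_analysis.

Set Implicit Arguments.
Unset Strict Implicit.
Unset Printing Implicit Defensive.

Import Order.TTheory GRing.Theory Num.Theory.
Import numFieldNormedType.Exports.

Local Open Scope classical_set_scope.
Local Open Scope ring_scope.

HB.mixin Record CompleteNormedModule_isHilbert (R : realType) X
    of CompleteNormedModule R X := {
  inner : X -> X -> R;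
  inner_linearl : forall (c : R) (x y z : X),
    inner (c *: x + y) z = c * inner x z + inner y z;
  inner_sym : forall x y : X, inner x y = inner y x;
  inner_norm : forall x : X, inner x x = `|x| ^+ 2
}.

#[short(type="hilbertType")]
HB.structure Definition Hilbert (R : realType) :=
  { X of CompleteNormedModule R X & CompleteNormedModule_isHilbert R X }.

Section HilbertSpaces.
Context {R : realType}.

Definition ortho {X : hilbertType R} (V : set X) : set X :=
  [set x | forall z, V z -> inner x z = 0].

(* Sequences are indexed from 0: index [n : nat] stands for the [n.+1]-st
   term of the usual enumeration by 1, 2, ... *)
Definition orthonormal {X : hilbertType R} (e : nat -> X) : Prop :=
  forall i j, inner (e i) (e j) = (i == j)%:R.

Definition lin_span {X : hilbertType R} (e : nat -> X) : set X :=
  [set x | exists (n : nat) (c : nat -> R), x = \sum_(i < n) c i *: e i].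

Definition orthonormal_basis {X : hilbertType R} (e : nat -> X) (V : set X)
    : Prop :=
  orthonormal e /\ closure (lin_span e) = V.

Definition nullspace {X Y : hilbertType R} (A : X -> Y) : set X :=
  [set x | A x = 0].

Definition compact_operator {X Y : hilbertType R} (A : X -> Y) : Prop :=
  forall B : set X, bounded_set B -> compact (closure (A @` B)).

Definition singular_value_expansion {X Y : hilbertType R} (A : X -> Y)
    (sigma : nat -> R) (u : nat -> X) (v : nat -> Y) : Prop :=
  [/\ forall n, 0 < sigma n,
      orthonormal_basis u (ortho (nullspace A)),
      orthonormal_basis v (closure (range A)) &
      forall x, series (fun n => (sigma n * inner x (u n)) *: v n) @ \oo
                  --> A x].

(* Moore-Penrose inverse: the inverse of [A] restricted to N(A)^perp, extended
   linearly by zero on R(A)^perp.  So for y in the domain R(A) + R(A)^perp the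
   value is the unique z in N(A)^perp with y - A z in R(A)^perp.  Outside this
   domain the value is 0 by convention. *)
Definition pinv {X Y : hilbertType R} (A : X -> Y) (y : Y) : X :=
  xget 0 [set z | ortho (nullspace A) z /\ ortho (range A) (y - A z)].

End HilbertSpaces.

Notation borelType X := (g_sigma_algebraType (@open X)).

(* A noise enters only through its coefficients e n = <eps, v n>, so a noise
   distribution is a probability measure on the space R^nat of coefficient
   sequences with its product sigma-algebra.  In particular eps need not take
   values in Y. *)
Notation noiseType R := (g_sigma_algebraType
  (\bigcup_(n in [set: nat])
     preimage_set_system [set: nat -> R] (fun e => e n)
       (@measurable _ (measurableTypeR R)))).

Section Regularization.
Context {R : realType} {X Y : hilbertType R}.

Definition admissible_noise (Pe : probability (noiseType R) R) : Prop :=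
  forall n : nat,
    ('E_Pe[fun e : nat -> R => (e n ^+ 2)%R] < +oo /\
     'E_Pe[fun e : nat -> R => e n] = 0)%E.

(* [fine] is harmless on finite second moments, which the standing assumptions
   on the data and noise distributions guarantee. *)
Definition Pi (u : nat -> X) (Px : probability (borelType X) R) (n : nat) : R :=
  fine 'E_Px[fun x => (inner (x : X) (u n) ^+ 2)%R]%E.

Definition Delta (Pe : probability (noiseType R) R) (n : nat) : R :=
  fine 'E_Pe[fun e : nat -> R => (e n ^+ 2)%R]%E.

Definition noise_level (Pe : probability (noiseType R) R) : \bar R :=
  sqrte (ereal_sup (range (fun n => (Delta Pe n)%:E))).

Definition noisy_coef (v : nat -> Y) (y : Y) (e : nat -> R) : nat -> R :=
  fun n => inner y (v n) + e n.

(* R[g], acting on the coefficient sequence c of the (possibly only formal)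
   datum.  [lim] is a conventional value if the series diverges. *)
Definition spectral_reg (u : nat -> X) (g c : nat -> R) : X :=
  lim (series (fun n => (g n * c n) *: u n) @ \oo).

(* The convention 0 / 0 = 0 is the one of [GRing.inv]. *)
Definition g_mse (sigma : nat -> R) (u : nat -> X)
    (Px : probability (borelType X) R) (Pe : probability (noiseType R) R)
    (n : nat) : R :=
  sigma n * Pi u Px n / (Pi u Px n * sigma n ^+ 2 + Delta Pe n).

Definition R_mse (sigma : nat -> R) (u : nat -> X)
    (Px : probability (borelType X) R) (Pe : probability (noiseType R) R)
    (c : nat -> R) : X :=
  spectral_reg u (g_mse sigma u Px Pe) c.

(* The product measure expresses the independence of data and noise. *)
Definition mse_error (A : X -> Y) (sigma : nat -> R) (u : nat -> X)
    (v : nat -> Y) (Px : probability (borelType X) R)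
    (Pe : probability (noiseType R) R) : \bar R :=
  (\int[(Px \x Pe)%E]_z
     (`|pinv A (A z.1) - R_mse sigma u Px Pe (noisy_coef v (A z.1) z.2)|
        ^+ 2)%:E)%E.

End Regularization.

(* Main.v *)
(* In the singular basis the error of the learned operator has coefficients
   (1 - g_n sigma_n) <x, u_n> - g_n <eps, v_n>.  By (p - q)^2 <= 2 p^2 + 2 q^2,
   its mean square is at most twice the sum over n of
   Pi_n Delta_n / (Pi_n sigma_n^2 + Delta_n) <= min(Pi_n, Delta_n / sigma_n^2),
   that is, up to constants, of min(n^-a, delta^2 n^b).  Splitting that sum at
   n = delta^(-2 / (a + b)), where the two bounds are equal, gives the rate. *)
Require Import Defs.
From mathcomp Require Import all_boot all_order all_algebra.
From mathcomp Require Import all_classical all_reals all_analysis.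
From mathcomp Require Import measurable_realfun.
From mathcomp Require Import ring lra.

Set Implicit Arguments.
Unset Strict Implicit.
Unset Printing Implicit Defensive.

Import Order.TTheory GRing.Theory Num.Theory.
Import numFieldNormedType.Exports.
Local Open Scope classical_set_scope.
Local Open Scope ring_scope.

(* These names are shadowed by MathComp-Analysis and MathComp. *)
Local Notation orthonormal := Defs.orthonormal.
Local Notation ortho := Defs.ortho.
Local Notation pinv := Defs.pinv.

(** * Orthonormal systems in a Hilbert space *)

Section Hilbert.
Context {R : realType} {X : hilbertType R}.
Implicit Types (x y z : X) (e : nat -> X) (c : nat -> R).

Lemma inner0l z : inner (0 : X) z = 0.
Proof.
have := inner_linearl 1 (0 : X) 0 z.
rewrite scaler0 addr0 mul1r => /eqP.
by rewrite -subr_eq0 opprD addNKr oppr_eq0 => /eqP.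
Qed.

Lemma innerDl x y z : inner (x + y) z = inner x z + inner y z.
Proof. by have := inner_linearl 1 x y z; rewrite scale1r mul1r. Qed.

Lemma innerZl (a : R) x z : inner (a *: x) z = a * inner x z.
Proof. by have := inner_linearl a x 0 z; rewrite addr0 inner0l addr0. Qed.

Lemma innerBl x y z : inner (x - y) z = inner x z - inner y z.
Proof. by rewrite innerDl -scaleN1r innerZl mulN1r. Qed.

Lemma inner_suml n (f : nat -> X) z :
  inner (\sum_(i < n) f i) z = \sum_(i < n) inner (f i) z.
Proof.
elim: n => [|n IH]; first by rewrite !big_ord0 inner0l.
by rewrite !big_ord_recr /= innerDl IH.
Qed.

Lemma sqr_normB x y : `|x - y| ^+ 2 = `|x| ^+ 2 - 2 * inner x y + `|y| ^+ 2.
Proof.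
rewrite -!inner_norm innerBl (inner_sym x (x - y)) (inner_sym y (x - y)).
by rewrite !innerBl (inner_sym y x); ring.
Qed.

Lemma cauchy_schwarz x y : `|inner x y| <= `|x| * `|y|.
Proof.
have [->|y0] := eqVneq y 0.
  by rewrite inner_sym inner0l !normr0 mulr0.
have N0 : 0 < `|y| by rewrite normr_gt0.
(* The residual of the orthogonal projection of [x] onto the line through [y]. *)
have := sqr_ge0 `|x - (inner x y / `|y| ^+ 2) *: y|.
rewrite sqr_normB inner_sym innerZl (inner_sym y x) normrZ exprMn.
rewrite real_normK ?num_real// => H.
rewrite -ler_sqr ?nnegrE ?mulr_ge0// real_normK ?num_real//.
rewrite exprMn -ler_pdivrMr ?exprn_gt0// -subr_ge0.
apply: le_trans H _; rewrite le_eqVlt; apply/orP; left; apply/eqP; field.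
by rewrite normr_eq0.
Qed.

Lemma inner_continuous z : continuous (fun x => inner x z).
Proof.
move=> x; apply/cvgrPdist_lt => /= eps eps0.
have z0 : 0 < `|z| + 1 by rewrite ltr_wpDl.
near=> y; rewrite -innerBl (le_lt_trans (cauchy_schwarz _ _))//.
apply: (@le_lt_trans _ _ (`|x - y| * (`|z| + 1))).
  by rewrite ler_wpM2l// lerDl.
rewrite -ltr_pdivlMr//; near: y.
by apply: (@cvgr_dist_lt _ _ _ _ _ id x) => //; rewrite divr_gt0.
Unshelve. all: by end_near. Qed.

Lemma orthonormal_inner_sum e c n k : orthonormal e ->
  inner (\sum_(i < n) c i *: e i) (e k) = if (k < n)%N then c k else 0.
Proof.
move=> oe; rewrite (inner_suml _ (fun i => c i *: e i)).
under eq_bigr do rewrite innerZl oe.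
elim: n => [|n IH]; first by rewrite big_ord0.
rewrite big_ord_recr /= IH ltnS.
by case: ltngtP => [kn|kn|->]; rewrite ?mulr0 ?mulr1 ?addr0 ?add0r.
Qed.

(** Pairing the block [s] with [e k] returns [c k], so it suffices to expand one factor of <s, s>.
    General blocks serve the Cauchy criterion below. *)
Lemma pythagoras e c m n : orthonormal e ->
  `|\sum_(m <= i < n) c i *: e i| ^+ 2 = \sum_(m <= i < n) c i ^+ 2.
Proof.
move=> oe; set s := \sum_(_ <= _ < _) _.
have inner_s k : (m <= k < n)%N -> inner s (e k) = c k.
  move=> /andP[mk kn]; rewrite /s.
  have mn : (m <= n)%N by rewrite ltnW// (leq_ltn_trans mk).
  have -> : \sum_(m <= i < n) c i *: e i =
            \sum_(0 <= i < n) c i *: e i - \sum_(0 <= i < m) c i *: e i.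
    by rewrite [X in _ = X - _](@big_cat_nat _ _ _ m 0 n)//= addrAC subrr add0r.
  rewrite innerBl !big_mkord !orthonormal_inner_sum// kn.
  by rewrite ltnNge mk subr0.
rewrite -inner_norm {1}/s.
transitivity (\sum_(m <= i < n) c i * inner (e i) s).
  elim/big_rec2: _ => [|i x y _ <-]; first by rewrite inner0l.
  by rewrite innerDl innerZl.
by apply: eq_big_nat => i mi; rewrite inner_sym inner_s.
Qed.

(** The partial Fourier sum [s] satisfies <x, s> = |s|^2, hence |x|^2 - |s|^2 = |x - s|^2 >= 0. *)
Lemma bessel e x n : orthonormal e ->
  \sum_(0 <= i < n) inner x (e i) ^+ 2 <= `|x| ^+ 2.
Proof.
move=> oe; set s := \sum_(0 <= i < n) inner x (e i) *: e i.
have sx : inner s x = \sum_(0 <= i < n) inner x (e i) ^+ 2.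
  rewrite /s; elim/big_rec2: _ => [|i y z _ <-]; first by rewrite inner0l.
  by rewrite innerDl innerZl (inner_sym (e i)).
have ss := @pythagoras e (fun i => inner x (e i)) 0 n oe.
rewrite -/s -inner_norm in ss.
have := sqr_ge0 `|x - s|; rewrite sqr_normB inner_sym sx -(inner_norm s) ss.
lra.
Qed.

(** By Pythagoras the squared norms of blocks are blocks of the real series of [c n ^+ 2], which
    converges because it is monotone and bounded. Completeness of [X] concludes. *)
Lemma orthonormal_series_cvg e c (B : R) : orthonormal e ->
  (forall n, \sum_(0 <= i < n) c i ^+ 2 <= B) ->
  cvgn (series (fun n => c n *: e n)).
Proof.
move=> oe cB; apply/cauchy_cvgP/cauchy_seriesP => eps eps0.
have c2 : cvgn (series (fun n => c n ^+ 2)).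
  apply: nondecreasing_is_cvgn.
    by apply: nondecreasing_series => i _ _; exact: sqr_ge0.
  by exists B => _ [n _ <-]; rewrite seriesEnat; exact: cB.
move/cauchy_cvgP/cauchy_seriesP : c2 => /(_ _ (exprn_gt0 2 eps0)).
apply: filterS => -[m n] /=.
rewrite -(pythagoras c _ _ oe) ger0_norm ?sqr_ge0//.
by rewrite ltr_sqr ?nnegrE// ltW.
Qed.

Lemma orthonormal_series_norm e c (B : R) x : orthonormal e ->
  (forall n, \sum_(0 <= i < n) c i ^+ 2 <= B) ->
  series (fun n => c n *: e n) @ \oo --> x -> `|x| ^+ 2 <= B.
Proof.
move=> oe cB cx.
have n2 : (fun n => `|series (fun n => c n *: e n) n| ^+ 2) @ \oo --> `|x| ^+ 2.
  by under eq_fun do rewrite expr2; rewrite expr2; apply: cvgM; exact: cvg_norm.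
rewrite -(cvg_lim _ n2)//; apply: limr_le.
  by apply/cvg_ex; eexists; exact: n2.
by near=> n; rewrite seriesEnat pythagoras.
Unshelve. all: by end_near. Qed.

Lemma orthonormal_series_inner e c x k : orthonormal e ->
  series (fun n => c n *: e n) @ \oo --> x -> inner x (e k) = c k.
Proof.
move=> oe cx.
have : (fun n => inner (series (fun n => c n *: e n) n) (e k)) @ \oo -->
    inner x (e k).
  exact: cvg_comp cx (@inner_continuous (e k) x).
move/cvg_unique; apply => //; apply: cvg_near_cst.
near=> n; rewrite seriesEord orthonormal_inner_sum//.
by have -> : (k < n)%N by near: n; exact: nbhs_infty_gt.
Unshelve. all: by end_near. Qed.

Lemma series_closure_lin_span e c x :
  series (fun n => c n *: e n) @ \oo --> x -> closure (lin_span e) x.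
Proof.
move=> cx; rewrite closureEcvg /=.
exists (series (fun n => c n *: e n) @ \oo); first exact: fmap_proper_filter.
split=> // V VE; exists 0%N => // n _ /=; apply: VE.
by exists n, c; rewrite seriesEord.
Qed.

End Hilbert.

(** * Singular value expansion and pointwise error *)

Section SVE.
Context {R : realType} {X Y : hilbertType R} {A : {linear X -> Y}}
  {sigma : nat -> R} {u : nat -> X} {v : nat -> Y}.
Hypothesis sveA : singular_value_expansion A sigma u v.

Lemma sve_inner x n : inner (A x) (v n) = sigma n * inner x (u n).
Proof.
case: sveA => _ _ [ov _] /(_ x) h.
exact: (orthonormal_series_inner n ov h).
Qed.

(** The limit [z] lies in N(A)^perp and has the same coefficients as [x], so A z = A x and [z] meets
    the specification of [pinv]. *)
Lemma pinv_series x :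
  series (fun n => inner x (u n) *: u n) @ \oo --> pinv A (A x).
Proof.
case: (sveA) => s0 [ou Vu] [ov Vv] sA.
have /cvg_ex[/= z cz] :=
  @orthonormal_series_cvg _ _ _ _ _ ou (fun n => bessel x n ou).
have zN : ortho (nullspace A) z.
  by rewrite -Vu; exact: series_closure_lin_span cz.
have Az : A z = A x.
  have := sA z; have := sA x.
  have -> : (fun n => (sigma n * inner z (u n)) *: v n) =
            (fun n => (sigma n * inner x (u n)) *: v n).
    by apply/funext => n; rewrite (orthonormal_series_inner n ou cz).
  by move=> h1 h2; apply: cvg_unique h2 h1.
suff -> : pinv A (A x) = z by [].
apply: xget_unique => [|z' [z'N z'A]].
  split=> // y _; rewrite Az subrr inner0l//.
(* For another candidate z', the vector A x - A z' is in R(A) and orthogonal to it, hence zero. So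
   z' - z is in both N(A) and N(A)^perp. *)
have AN : A (z' - z) = 0.
  have : inner (A x - A z') (A x - A z') = 0.
    by apply: z'A; exists (x - z') => //; rewrite linearB.
  rewrite inner_norm => /eqP; rewrite sqrf_eq0 normr_eq0 subr_eq0 => /eqP h.
  by rewrite linearB /= Az -h subrr.
have : inner (z' - z) (z' - z) = 0 by rewrite innerBl z'N// zN// subrr.
by rewrite inner_norm => /eqP; rewrite sqrf_eq0 normr_eq0 subr_eq0 => /eqP.
Qed.

(* If the right-hand side is finite, then the series defining [spectral_reg]
   converges. *)
Lemma reg_error_le (g : nat -> R) (e : nat -> R) x :
  ((`|pinv A (A x) - spectral_reg u g (noisy_coef v (A x) e)| ^+ 2)%:E <=
   \sum_(0 <= n <oo) (2 * (1 - g n * sigma n) ^+ 2 * inner x (u n) ^+ 2 +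
                           2 * g n ^+ 2 * e n ^+ 2)%:E)%E.
Proof.
case: (sveA) => s0 [ou Vu] [ov Vv] sA.
pose F n := 2 * (1 - g n * sigma n) ^+ 2 * inner x (u n) ^+ 2 +
  2 * g n ^+ 2 * e n ^+ 2.
rewrite -[leRHS]/(\sum_(0 <= n <oo) (F n)%:E)%E.
have F0 n : 0 <= F n.
  by apply: addr_ge0; apply: mulr_ge0; rewrite ?sqr_ge0// mulr_ge0 ?sqr_ge0.
have F0E n : (0 <= n)%N -> true -> (0 <= (F n)%:E)%E.
  by move=> _ _; rewrite lee_fin.
have := nneseries_ge0 F0E.
(* An infinite right-hand side is trivial; a finite one, [B], bounds every partial sum. *)
case: (\sum_(0 <= n <oo) _)%E (fun k => nneseries_lim_ge k F0E) =>
  [B FB _|_ _|//]; last by rewrite leey.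
rewrite lee_fin.
pose c n := inner x (u n) - g n * noisy_coef v (A x) e n.
have cB n : \sum_(0 <= i < n) c i ^+ 2 <= B.
  have := FB n; rewrite sumEFin lee_fin; apply: le_trans.
  apply: ler_sum => i _; rewrite /c /F /noisy_coef sve_inner.
  set p := g i * sigma i; set q := inner x (u i).
  (* This is 2 r^2 + 2 s^2 - (r - s)^2 = (r + s)^2. *)
  rewrite -subr_ge0 [leRHS](_ : _ = ((1 - p) * q + g i * e i) ^+ 2) ?sqr_ge0//.
  by rewrite /p; ring.
have /cvg_ex[/= w cw] := @orthonormal_series_cvg _ _ _ _ _ ou cB.
(* The regularized series is a difference of two convergent series, so the [lim] in [spectral_reg]
   is a genuine limit. *)
have cr : series (fun n => (g n * noisy_coef v (A x) e n) *: u n) @ \oo -->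
    pinv A (A x) - w.
  have -> : series (fun n => (g n * noisy_coef v (A x) e n) *: u n) =
     series (fun n => inner x (u n) *: u n) - series (fun n => c n *: u n).
    apply/funext => n; rewrite !fctE !seriesEnat /= -sumrB.
    by apply: eq_bigr => i _; rewrite -scalerBl /c subKr.
  by apply: cvgB => //; exact: pinv_series.
rewrite /spectral_reg (cvg_lim _ cr)// subKr.
exact: orthonormal_series_norm cw.
Qed.

End SVE.

(** * Sums of powers by telescoping *)

Section PowerSums.
Context {R : realType}.
Implicit Types (a b p q x : R).

(** Combines exp s >= 1 + s with ln x >= 1 - 1/x. For x = (z + 1) / z the bracket is exactly 1 / (z
    + 1). *)
Lemma powR_ge1D x p : 0 < x -> 0 <= p -> 1 + p * (1 - x^-1) <= x `^ p.
Proof.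
move=> x0 p0; rewrite /powR gt_eqF//; apply: le_trans (expR_ge1Dx _).
rewrite lerD2l ler_wpM2l// -[x in ln x]invrK lnV ?posrE ?invr_gt0//.
have := @le_ln1Dx R (x^-1 - 1); rewrite (addrC 1) subrK => h.
rewrite -[leLHS]opprB lerN2; apply: h.
by rewrite ltrBDr addrC subrr invr_gt0.
Qed.

(** Discrete counterpart of integrating y^-(p+1): apply [powR_ge1D] to y / z and multiply by
    y^-p. *)
Lemma powR_increment_tail p (i : nat) : 0 < p ->
  i.+2%:R `^ (- (p + 1)) <= p^-1 * (i.+1%:R `^ (- p) - i.+2%:R `^ (- p)).
Proof.
move=> p0; set y : R := i.+2%:R; set z : R := i.+1%:R.
have z0 : 0 < z by rewrite ltr0n.
have y0 : 0 < y by rewrite ltr0n.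
have yz : y = z + 1 by rewrite /y /z -natr1.
have x0 : 0 < y / z by rewrite divr_gt0.
have := powR_ge1D x0 (ltW p0).
have -> : 1 - (y / z)^-1 = y^-1 by rewrite invf_div yz; field.
rewrite powRM ?invr_ge0 ?(ltW z0) ?(ltW y0)//.
rewrite -(powR_inv1 (ltW z0)) -powRrM mulN1r.
rewrite -(ler_pM2l (powR_gt0 (- p) y0)) mulrA -powRD ?(gt_eqF y0) ?implybT//.
rewrite addNr powRr0 mul1r => h.
rewrite ler_pdivlMl// opprD powRD ?(gt_eqF y0) ?implybT// (powR_inv1 (ltW y0)).
by rewrite lerBrDl; move: h; rewrite mulrDr mulr1 mulrCA.
Qed.

(** [powR_ge1D] gives y^q - z^q >= y^q q / (y + q), and y >= 1 gives y + q <= (1 + q) y. This treats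
    q < 1 and q >= 1 alike. *)
Lemma powR_increment_head q (i : nat) : 0 < q ->
  i.+1%:R `^ (q - 1) <= (1 + q) / q * (i.+1%:R `^ q - i%:R `^ q).
Proof.
move=> q0; set y : R := i.+1%:R; set z : R := i%:R.
have y1 : 1 <= y by rewrite ler1n.
have y0 : 0 < y by rewrite ltr0n.
have yz : y = z + 1 by rewrite /y /z -natr1.
have key : z `^ q * (1 + q / y) <= y `^ q.
  have [z0|z0] := eqVneq z 0.
    by rewrite z0 powR0 ?gt_eqF// mul0r powR_ge0.
  have {}z0 : 0 < z by rewrite lt_def z0 ler0n.
  have x0 : 0 < y / z by rewrite divr_gt0.
  have := powR_ge1D x0 (ltW q0).
  have -> : 1 - (y / z)^-1 = y^-1 by rewrite invf_div yz; field.
  rewrite -(ler_pM2l (powR_gt0 q z0)) => /le_trans; apply.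
  by rewrite -powRM ?(ltW z0) ?(ltW x0)// mulrC divfK ?gt_eqF.
have {key} : z `^ q <= y `^ q * (y / (y + q)).
  rewrite mulrA ler_pdivlMr ?addr_gt0// -(ler_pdivrMr _ _ y0) -mulrA.
  by rewrite mulrDl divff ?gt_eqF.
move=> h; rewrite powRB ?(gt_eqF y0) ?implybT// powRr1 ?(ltW y0)//.
apply: (@le_trans _ _ ((1 + q) / q * (y `^ q * (q / (y + q))))); last first.
  rewrite ler_wpM2l ?divr_ge0 ?addr_ge0 ?(ltW q0)//.
  have -> : q / (y + q) = 1 - y / (y + q) by field; rewrite gt_eqF// addr_gt0.
  by rewrite mulrBr mulr1 lerD2l lerN2.
have -> : (1 + q) / q * (y `^ q * (q / (y + q))) = y `^ q * ((1 + q) / (y + q)).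
  by field; rewrite !gt_eqF// addr_gt0.
rewrite ler_wpM2l ?powR_ge0// ler_pdivlMr ?addr_gt0// ler_pdivrMl//.
nra.
Qed.

Lemma powR_sum_head q (m : nat) : 0 < q ->
  \sum_(0 <= i < m) i.+1%:R `^ (q - 1) <= (1 + q) / q * m%:R `^ q.
Proof.
move=> q0; have -> : m%:R `^ q = m%:R `^ q - 0%:R `^ q.
  by rewrite powR0 ?subr0 ?gt_eqF.
rewrite -(telescope_sumr (fun i => i%:R `^ q) (leq0n m)) mulr_sumr.
by apply: ler_sum => i _; exact: powR_increment_head.
Qed.

Lemma powR_sum_tail p (m n : nat) : 0 < p ->
  \sum_(m <= i < n) i.+1%:R `^ (- (p + 1)) <= (1 + p^-1) * m.+1%:R `^ (- p).
Proof.
move=> p0; have [nm|mn] := leqP n m.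
  by rewrite big_geq// mulr_ge0 ?powR_ge0// addr_ge0// invr_ge0 ltW.
have m1 : 1 <= m.+1%:R :> R by rewrite ler1n.
(* The first term is split off, since for m = 0 its increment would start at 0; it accounts for the
   1 in the constant. *)
rewrite big_ltn// mulrDl mul1r lerD ?ler_powR//; first lra.
case: n mn => // n mn; rewrite big_add1 /=.
apply: (@le_trans _ _ (\sum_(m <= i < n)
    p^-1 * - (i.+2%:R `^ (- p) - i.+1%:R `^ (- p)))).
  by apply: ler_sum => i _; rewrite opprB; exact: powR_increment_tail.
rewrite -mulr_sumr sumrN (telescope_sumr (fun i => i.+1%:R `^ (- p)))//.
by rewrite ler_wpM2l ?invr_ge0 ?(ltW p0)// opprB lerBlDr lerDl powR_ge0.
Qed.

(* The two bounds cross at n = t := delta ^ (-2 / (a + b)); there both partial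
   sums are of order t ^ (1 - a). *)
Lemma sum_min_powR_le a b (M C delta : R) (f : nat -> R) (N : nat) :
  1 < a -> -1 < b -> 0 <= M -> 0 <= C -> 0 < delta ->
  (forall i, 0 <= f i) ->
  (forall i, f i <= M * i.+1%:R `^ (- a)) ->
  (forall i, f i <= C * delta ^+ 2 * i.+1%:R `^ b) ->
  \sum_(0 <= i < N) f i <=
    (C * ((1 + (b + 1)) / (b + 1)) + M * (1 + (a - 1)^-1)) *
    delta `^ (2 * ((a - 1) / (a + b))).
Proof.
move=> a1 b1 M0 C0 d0 f0 fM fC.
have p0 : 0 < a - 1 by lra.
(* Here b > -1 enters: the head sum of n^b then grows like a positive power. *)
have q0 : 0 < b + 1 by lra.
have ab0 : a + b != 0 by rewrite gt_eqF//; lra.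
pose t := delta `^ (- (2 / (a + b))).
have t0 : 0 < t by rewrite powR_gt0.
have -> : delta `^ (2 * ((a - 1) / (a + b))) = t `^ (- (a - 1)).
  by rewrite /t -powRrM; congr powR; field.
have d2 : delta ^+ 2 = t `^ (- (a + b)).
  by rewrite /t -powRrM -powR_mulrn ?(ltW d0)//; congr powR; field.
have /andP[mt tm] := truncn_itv (ltW t0).
set m := Num.trunc t in mt tm.
(* Lengthening the sum makes the split at [m] valid for every [N]. *)
apply: (@le_trans _ _ (\sum_(0 <= i < m + N) f i)).
  rewrite [leRHS](@big_cat_nat _ _ _ N)//= ?leq_addl// lerDl.
  by apply: sumr_ge0.
rewrite (@big_cat_nat _ _ _ m)//= ?leq_addr// mulrDl lerD//.
(* Head: m <= t bounds it by a multiple of t^-(a+b) t^(b+1). *)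
- apply: (@le_trans _ _ (C * delta ^+ 2 *
      (\sum_(0 <= i < m) i.+1%:R `^ ((b + 1) - 1)))).
    by rewrite mulr_sumr; apply: ler_sum => i _; rewrite addrK.
  rewrite d2 -(mulrA C) -(mulrA C) ler_wpM2l//.
  have -> : - (a - 1) = - (a + b) + (b + 1) by lra.
  rewrite powRD ?(gt_eqF t0) ?implybT// mulrCA.
  rewrite ler_wpM2l ?powR_ge0//.
  apply: le_trans (powR_sum_head m q0) _.
  rewrite ler_wpM2l ?divr_ge0 ?(ltW q0)//; first lra.
  by rewrite ge0_ler_powR ?nnegrE ?(ltW q0) ?(ltW t0).
(* Tail: t < m + 1 and the exponent -(a-1) is negative. *)
- apply: (@le_trans _ _ (M *
      (\sum_(m <= i < m + N) i.+1%:R `^ (- ((a - 1) + 1))))).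
    by rewrite mulr_sumr; apply: ler_sum => i _; rewrite subrK.
  rewrite -!mulrA ler_wpM2l//.
  apply: le_trans (powR_sum_tail _ _ p0) _.
  rewrite ler_wpM2l ?addr_ge0 ?invr_ge0 ?(ltW p0)//.
  rewrite !powRN lef_pV2 ?posrE ?powR_gt0 ?ltr0n//.
  by rewrite ge0_ler_powR ?nnegrE ?(ltW p0) ?(ltW t0) ?(ltW tm).
Qed.

End PowerSums.

(** * Integrals and second moments *)

Section Measure.
Context {R : realType}.

(* No measurability is needed: the integral of a nonnegative function is a
   supremum over the simple functions below it. *)
Lemma ge0_le_integralT d (T : measurableType d)
    (mu : {measure set T -> \bar R}) (f g : T -> \bar R) :
  (forall x, 0 <= f x)%E -> (forall x, f x <= g x)%E ->
  (\int[mu]_x f x <= \int[mu]_x g x)%E.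
Proof.
move=> f0 fg; have g0 x : (0 <= g x)%E by exact: le_trans (f0 x) (fg x).
rewrite !ge0_integralTE//; apply: ereal_sup_le => _ [h hf <-].
by exists h => // x; exact: le_trans (hf x) (fg x).
Qed.

(** Each summand depends on one variable; Tonelli integrates out the other, of total mass 1. *)
Lemma integral_prod_comb d1 d2 (T1 : measurableType d1)
    (T2 : measurableType d2) (P1 : probability T1 R) (P2 : probability T2 R)
    (f1 : T1 -> R) (f2 : T2 -> R) (p q : R) :
  measurable_fun setT f1 -> measurable_fun setT f2 ->
  (forall x, 0 <= f1 x) -> (forall x, 0 <= f2 x) -> 0 <= p -> 0 <= q ->
  (\int[(P1 \x P2)%E]_z (p * f1 z.1 + q * f2 z.2)%:E =
   p%:E * \int[P1]_x (f1 x)%:E + q%:E * \int[P2]_x (f2 x)%:E)%E.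
Proof.
move=> mf1 mf2 f10 f20 p0 q0.
pose F1 (z : T1 * T2) : \bar R := (f1 z.1)%:E.
have m1 : measurable_fun setT F1.
  by apply/measurable_EFinP; apply: measurableT_comp.
pose F2 (z : T1 * T2) : \bar R := (f2 z.2)%:E.
have m2 : measurable_fun setT F2.
  by apply/measurable_EFinP; apply: measurableT_comp.
under eq_integral do rewrite EFinD !EFinM -/(F1 _) -/(F2 _).
rewrite ge0_integralD//=; first last.
- exact: measurable_funeM.
- by move=> x _; rewrite -EFinM lee_fin mulr_ge0.
- exact: measurable_funeM.
- by move=> x _; rewrite -EFinM lee_fin mulr_ge0.
rewrite !ge0_integralZl//; do ?by move=> x _; rewrite lee_fin.
congr (_ * _ + _ * _)%E.
- rewrite fubini_tonelli1//; last by move=> x; rewrite lee_fin.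
  apply: eq_integral => x _; rewrite /fubini_F /=.
  by rewrite (integral_cst P2 measurableT (f1 x)%:E)
    [X in (_ * X)%E]probability_setT mule1.
- rewrite fubini_tonelli2//; last by move=> x; rewrite lee_fin.
  apply: eq_integral => x _; rewrite /fubini_G /=.
  by rewrite (integral_cst P1 measurableT (f2 x)%:E)
    [X in (_ * X)%E]probability_setT mule1.
Qed.

Lemma measurable_inner (X : hilbertType R) (z : X) :
  measurable_fun setT (fun x : borelType X => inner (x : X) z).
Proof.
apply: (measurability _ (RGenOpens.measurableE R)) => _ [_ [a [b ->]] <-].
rewrite setTI; apply: sub_sigma_algebra.
have /continuousP := @inner_continuous R X z; apply.
exact: interval_open.
Qed.

Lemma measurable_coordinate (n : nat) :
  measurable_fun setT (fun e : noiseType R => e n).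
Proof.
move=> _ B mB; apply: sub_sigma_algebra; exists n => //.
by exists B.
Qed.

Lemma Pi_ge0 (X : hilbertType R) (u : nat -> X) Px n : 0 <= Pi u Px n.
Proof.
by rewrite /Pi fine_ge0// unlock integral_ge0// => x _; rewrite lee_fin sqr_ge0.
Qed.

Lemma Delta_ge0 (Pe : probability (noiseType R) R) n : 0 <= Delta Pe n.
Proof.
rewrite /Delta fine_ge0// unlock.
by rewrite integral_ge0// => x _; rewrite lee_fin sqr_ge0.
Qed.

(** One squared coefficient is at most |x|^2 by Bessel, so the moment is finite and [fine] loses
    nothing. *)
Lemma integral_PiE (X : hilbertType R) (u : nat -> X)
    (Px : probability (borelType X) R) n :
  orthonormal u -> ('E_Px[fun x : X => (`|x| ^+ 2)%R] < +oo)%E ->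
  (\int[Px]_x (inner (x : X) (u n) ^+ 2)%:E = (Pi u Px n)%:E)%E.
Proof.
move=> ou; rewrite /Pi !unlock => Pfin; rewrite fineK//.
rewrite ge0_fin_numE; last first.
  by apply: integral_ge0 => x _; rewrite lee_fin sqr_ge0.
apply: le_lt_trans Pfin; apply: ge0_le_integralT => x;
  rewrite lee_fin ?sqr_ge0//.
have := @bessel _ _ u x n.+1 ou; rewrite big_nat_recr//=; apply: le_trans.
by rewrite lerDr sumr_ge0// => i _; exact: sqr_ge0.
Qed.

Lemma integral_DeltaE (Pe : probability (noiseType R) R) n :
  admissible_noise Pe -> (\int[Pe]_e (e n ^+ 2)%:E = (Delta Pe n)%:E)%E.
Proof.
move=> /(_ n)[]; rewrite /Delta !unlock => Dfin _; rewrite fineK//.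
by rewrite ge0_fin_numE//; apply: integral_ge0 => x _; rewrite lee_fin sqr_ge0.
Qed.

(** The finitely many indices before the asymptotic bound are absorbed into the constant. *)
Lemma eqO_nat_bound (f g : nat -> R) : (forall n, 0 < g n) -> f =O_\oo g ->
  exists2 M : R, 0 <= M & forall n, f n <= M * g n.
Proof.
move=> g0 /eqO_exP[k k0 [N _ Nk]].
exists (k + \sum_(i < N) `|f i| / g i) => [|n].
  by rewrite addr_ge0 ?(ltW k0)// sumr_ge0// => i _; rewrite divr_ge0// ltW.
have [Nn|nN] := leqP N n.
  apply: le_trans (ler_norm _) _; apply: le_trans (Nk n Nn) _.
  rewrite (gtr0_norm (g0 n)) ler_wpM2r ?(ltW (g0 n))// lerDl.
  by rewrite sumr_ge0// => i _; rewrite divr_ge0// ltW.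
rewrite (bigD1 (Ordinal nN))//= addrCA mulrDl divfK ?gt_eqF//.
apply: le_trans (ler_norm _) _; rewrite lerDl mulr_ge0 ?(ltW (g0 n))//.
by rewrite addr_ge0 ?(ltW k0)// sumr_ge0// => i _; rewrite divr_ge0// ltW.
Qed.

End Measure.

(** * Mean square error of the learned operator *)

Section MSE.
Context {R : realType} {X Y : hilbertType R} {A : {linear X -> Y}}
  {sigma : nat -> R} {u : nat -> X} {v : nat -> Y}
  {Px : probability (borelType X) R} {Pe : probability (noiseType R) R}.
Hypothesis sveA : singular_value_expansion A sigma u v.
Hypothesis Px_moment : ('E_Px[fun x : X => (`|x| ^+ 2)%R] < +oo)%E.
Hypothesis Pe_noise : admissible_noise Pe.

Let g := g_mse sigma u Px Pe.

(** The expectation of the n-th summand in [reg_error_le]. *)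
Definition mse_term n :=
  2 * (1 - g n * sigma n) ^+ 2 * Pi u Px n + 2 * g n ^+ 2 * Delta Pe n.

Lemma mse_term_ge0 n : 0 <= mse_term n.
Proof.
apply: addr_ge0; apply: mulr_ge0; rewrite ?Pi_ge0 ?Delta_ge0//;
  by rewrite mulr_ge0 ?sqr_ge0.
Qed.

(** The pointwise bound is integrated term by term; nonnegativity permits exchanging sum and
    integral, and measurability is checked only for the majorant. *)
Lemma mse_error_le :
  (mse_error A sigma u v Px Pe <= \sum_(0 <= n <oo) (mse_term n)%:E)%E.
Proof.
rewrite /mse_error.
apply: le_trans.
  apply: ge0_le_integralT => z; first by rewrite lee_fin sqr_ge0.
  exact: (reg_error_le sveA g z.2 z.1).
pose p n := 2 * (1 - g n * sigma n) ^+ 2; pose q n := 2 * g n ^+ 2.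
have p0 n : 0 <= p n by rewrite mulr_ge0 ?sqr_ge0.
have q0 n : 0 <= q n by rewrite mulr_ge0 ?sqr_ge0.
have mX n :
    measurable_fun setT (fun x : borelType X => inner (x : X) (u n) ^+ 2).
  by apply: measurable_funX; exact: measurable_inner.
have mE n : measurable_fun setT (fun e : noiseType R => e n ^+ 2).
  by apply: measurable_funX; exact: measurable_coordinate.
rewrite integral_nneseries//; first last.
- by move=> n z _;
    rewrite lee_fin addr_ge0// mulr_ge0 ?sqr_ge0 ?p0 ?q0.
- move=> n; apply/measurable_EFinP.
  apply: measurable_funD; apply: measurable_funM => //.
    exact: (measurableT_comp (mX n)).
  exact: (measurableT_comp (mE n)).
apply: lee_nneseries => [n _ _|n _].
  by apply: integral_ge0 => z _;
    rewrite lee_fin addr_ge0// mulr_ge0 ?sqr_ge0 ?p0 ?q0.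
have /= -> := integral_prod_comb Px Pe (mX n) (mE n)
  (fun x => sqr_ge0 _) (fun e => sqr_ge0 _) (p0 n) (q0 n).
case: sveA => _ [ou _] _ _.
rewrite (integral_PiE n ou Px_moment) (integral_DeltaE n Pe_noise).
by rewrite -!EFinM -EFinD lee_fin.
Qed.

Lemma mse_term_le n :
  mse_term n <= 2 * Pi u Px n /\ mse_term n <= 2 * (Delta Pe n / sigma n ^+ 2).
Proof.
case: (sveA) => /(_ n) s0 _ _ _.
rewrite /mse_term /g /g_mse.
have := Pi_ge0 u Px n; have := Delta_ge0 Pe n; move: s0.
move: (sigma n) (Pi u Px n) (Delta Pe n) => s p D s0 D0 p0.
have ps0 : 0 <= p * s ^+ 2 by rewrite mulr_ge0 ?sqr_ge0.
(* A zero denominator forces p = D = 0 because s > 0, and everything vanishes. *)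
have [E0|E0] := eqVneq (p * s ^+ 2 + D) 0.
  have D00 : D = 0 by lra.
  have /eqP : p * s ^+ 2 = 0 by lra.
  rewrite mulf_eq0 sqrf_eq0 (gt_eqF s0) orbF => /eqP ->.
  by rewrite D00 !(mulr0, mul0r, addr0).
have {}E0 : 0 < p * s ^+ 2 + D by rewrite lt_def E0 addr_ge0.
set q := (X in X <= _ /\ X <= _).
(* Dropping either summand of the denominator gives one of the two bounds. *)
have -> : q = 2 * (D * p / (p * s ^+ 2 + D)).
  by rewrite /q; field; rewrite gt_eqF.
split; rewrite ler_pM2l// ler_pdivrMr//.
  by rewrite mulrC ler_wpM2l// lerDr.
rewrite -mulrA ler_wpM2l// ler_pdivlMl ?exprn_gt0// mulrC lerDl//.
Qed.

End MSE.

(** * The convergence rate *)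

Theorem theorem2 (R : realType) (X Y : hilbertType R) (A : {linear X -> Y})
    (sigma : nat -> R) (u : nat -> X) (v : nat -> Y)
    (Px : probability (borelType X) R)
    (Psi : set (probability (noiseType R) R)) (a b : R)
    (compactA : compact_operator A)
    (sveA : singular_value_expansion A sigma u v)
    (Px_moment : ('E_Px[fun x : X => (`|x| ^+ 2)%R] < +oo)%E)
    (Psi_noise : forall Pe, Psi Pe -> admissible_noise Pe)
    (a_gt1 : 1 < a) (b_gtN1 : -1 < b)
    (Pi_decay : Pi u Px =O_\oo (fun n : nat => n.+1%:R `^ (- a)))
    (Delta_bound : exists C : R, forall Pe, Psi Pe -> forall n : nat,
       ((Delta Pe n / sigma n ^+ 2)%:E
          <= C%:E * noise_level Pe ^+ 2 * (n.+1%:R `^ b)%:E)%E) :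
  exists K : R, forall delta : R, 0 <= delta ->
    (ereal_sup [set mse_error A sigma u v Px Pe
                 | Pe in [set Pe | Psi Pe /\ (noise_level Pe <= delta%:E)%E]]
       <= (K * delta `^ (2 * ((a - 1) / (a + b))))%:E)%E.
Proof.
have [M M0 PiM] : exists2 M : R, 0 <= M &
    forall n, Pi u Px n <= M * n.+1%:R `^ (- a).
  by apply: eqO_nat_bound => // n; rewrite powR_gt0.
have [C DeltaC] := Delta_bound.
(* The constant of [sum_min_powR_le] at 2 M and 2 |C|; the factors 2 come from [mse_term_le], and
   [C] may be negative. *)
exists (2 * `|C| * ((1 + (b + 1)) / (b + 1)) + 2 * M * (1 + (a - 1)^-1)).
move=> delta delta0; apply: ge_ereal_sup => _ [Pe [PsiPe Pedelta] <-].
pose f := @mse_term R X sigma u Px Pe.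
have f0 n : 0 <= f n by exact: mse_term_ge0.
have fM n : f n <= 2 * M * n.+1%:R `^ (- a).
  have [h _] := @mse_term_le R X Y A sigma u v Px Pe sveA n.
  by apply: le_trans h _; rewrite -mulrA ler_pM2l.
have fC n : f n <= 2 * `|C| * delta ^+ 2 * n.+1%:R `^ b.
  have [_ h] := @mse_term_le R X Y A sigma u v Px Pe sveA n.
  apply: le_trans h _; rewrite -!(mulrA 2) ler_pM2l//.
  have := DeltaC Pe PsiPe n; move: Pedelta.
  have : (0 <= noise_level Pe)%E by exact: sqrte_ge0.
  case: (noise_level Pe) => // l; rewrite !lee_fin => l0 ld.
  move/le_trans; apply; rewrite ler_wpM2r ?powR_ge0//.
  apply: (@le_trans _ _ (`|C| * l ^+ 2)).
    by rewrite ler_wpM2r ?sqr_ge0 ?ler_norm.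
  by rewrite ler_wpM2l// ler_sqr.
apply: le_trans (mse_error_le sveA Px_moment (Psi_noise _ PsiPe)) _.
apply: lime_le.
  by apply: is_cvg_nneseries => n _ _; rewrite lee_fin f0.
near=> N; rewrite sumEFin lee_fin.
(* For delta = 0 there is no crossing point t, but every term is at most 0, as is the bound since
   its exponent is positive. *)
have [delta_eq0|delta_neq0] := eqVneq delta 0.
  have r0 : 0 < 2 * ((a - 1) / (a + b)).
    have a10 : 0 < a - 1 by lra.
    have ab0 : 0 < a + b by lra.
    by rewrite mulr_gt0// divr_gt0.
  rewrite delta_eq0 powR0 ?(gt_eqF r0)// mulr0.
  apply: sumr_le0 => i _; apply: le_trans (fC i) _.
  by rewrite delta_eq0 expr0n mulr0 mul0r.
apply: sum_min_powR_le => //; rewrite ?mulr_ge0//.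
by rewrite lt_def delta_neq0.
Unshelve. all: by end_near. Qed.
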